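(* Let $k,g,\rho,\omega>0$, $b_0\le 0$, $P_0\in\mathbb{R}$, $m\in\mathbb{R}$, and let the wave speed be given by $$c:=\frac{g-km^2}{2\omega}.$$ Let $(u,w)$ be the velocity field associated with the particle paths $(X,Z)$ (see context), and let the pressure be $$P:=\frac{\rho m(km+2\omega)}{2k}\left(e^{2kb}-e^{2kb_0}\right)+\left[2\omega\rho(c-m)-g\rho\right](b-b_0)+P_0,\qquad b\le b_0,$$ regarded as a function of $(t,X,Z)$ through $(a,b)=\Phi(t)^{-1}(X,Z)$. Then, for all $t\ge0$, $$u_t+uu_X+wu_Z+2\omega w=-\frac{P_X}{\rho},\qquad w_t+uw_X+ww_Z-2\omega u=-\frac{P_Z}{\rho}-g\qquad\text{in }\Omega(t).$$
   Context: For $t\ge 0$, $a\in\mathbb{R}$, $b\le b_0$ the particle paths are $$X(t,a,b):=a+(c-m)t-\frac{e^{kb}}{k}\sin(k(a-mt)),\qquad Z(t,a,b):=b+\frac{e^{kb}}{k}\cos(k(a-mt)).$$ Set $\Sigma:=\mathbb{R}\times(-\infty,b_0)$ and $\Phi(t):=(X(t,\cdot,\cdot),Z(t,\cdot,\cdot))$. For each $t\ge0$, $\Phi(t)$ is a real-analytic diffeomorphism of $\Sigma$ onto the fluid domain $\Omega(t):=\Phi(t)(\Sigma)$. The velocity field is defined by $$u(t,X,Z)=X_t(t,a,b)\big|_{(a,b)=\Phi(t)^{-1}(X,Z)},\qquad w(t,X,Z)=Z_t(t,a,b)\big|_{(a,b)=\Phi(t)^{-1}(X,Z)}.$$ *)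

(* Defs.v *)
From Stdlib Require Import Reals ClassicalEpsilon.
From Coquelicot Require Import Coquelicot.
Open Scope R_scope.

Definition Xpath (k m c t a b : R) : R :=
  a + (c - m) * t - exp (k * b) / k * sin (k * (a - m * t)).

Definition Zpath (k m t a b : R) : R :=
  b + exp (k * b) / k * cos (k * (a - m * t)).

Definition Sigma (b0 : R) (ab : R * R) : Prop := snd ab < b0.

Definition Phi (k m c t : R) (ab : R * R) : R * R :=
  (Xpath k m c t (fst ab) (snd ab), Zpath k m t (fst ab) (snd ab)).

Definition Omega (k m c b0 t : R) (p : R * R) : Prop :=
  exists ab : R * R, Sigma b0 ab /\ Phi k m c t ab = p.

(* The inverse of [Phi t : Sigma -> Omega t]; unspecified off [Omega t]. *)
Definition Phi_inv (k m c b0 t : R) (p : R * R) : R * R :=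
  epsilon (inhabits (0, 0)) (fun ab => Sigma b0 ab /\ Phi k m c t ab = p).

Definition velocity_u (k m c b0 t x z : R) : R :=
  let ab := Phi_inv k m c b0 t (x, z) in
  Derive (fun s => Xpath k m c s (fst ab) (snd ab)) t.

Definition velocity_w (k m c b0 t x z : R) : R :=
  let ab := Phi_inv k m c b0 t (x, z) in
  Derive (fun s => Zpath k m s (fst ab) (snd ab)) t.

Definition pressure_label (k g rho omega b0 P0 m c b : R) : R :=
  rho * m * (k * m + 2 * omega) / (2 * k) * (exp (2 * k * b) - exp (2 * k * b0))
  + (2 * omega * rho * (c - m) - g * rho) * (b - b0) + P0.

Definition pressure (k g rho omega b0 P0 m c t x z : R) : R :=
  pressure_label k g rho omega b0 P0 m c (snd (Phi_inv k m c b0 t (x, z))).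

(* [l] is the derivative of [f] at [t] as a function on [0, +oo): the usual
   derivative for [t > 0], the right derivative at [t = 0]. *)
Definition is_time_derive (f : R -> R) (t l : R) : Prop :=
  D_in f (fun _ => l) (fun s => 0 <= s) t.

(* Main.v *)
Require Import Defs.
From Stdlib Require Import Reals Lra Psatz ClassicalEpsilon.
From Coquelicot Require Import Coquelicot.
Open Scope R_scope.

(** In the frame moving with speed [c] the particle map is time-independent:
    with the phase [a - m t] as first label it becomes [F p = p + h p], where [h]
    has Lipschitz constant [exp (k beta) < 1] on each half-plane
    [b <= beta < 0].  Hence [F] is injective and expansive there, and the
    contraction principle makes it locally onto with Lipschitz inverse; the
    inverse is then differentiable by inverting the linearization, whose
    determinant is [1 - exp (2 k b)].  So [u], [w], [P] are functions of
    [(X - c t, Z)] with explicit derivatives, and the Euler equations become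
    algebraic identities modulo [sin^2 + cos^2 = 1] and
    [g = 2 omega c + k m^2]. *)

(** * Contractions of the plane *)

(** The increments form a series dominated by a geometric one, and the iterates are its partial sums
    shifted by [x 0]. Applied to each coordinate of a Picard iteration. *)
Lemma ex_lim_seq_of_geometric_increments (x : nat -> R) (L d : R) :
  0 <= L < 1 -> (forall n, Rabs (x (S n) - x n) <= L ^ n * d) ->
  exists l : R, is_lim_seq x l.
Proof.
intros HL Hx.
assert (He : ex_series (fun n => x (S n) - x n)).
{ apply (ex_series_le (K := R_AbsRing) (V := R_CompleteNormedModule))
    with (fun n => L ^ n * d).
  - exact Hx.
  - apply (ex_series_scal_r d (fun n => L ^ n)).
    apply ex_series_geom. rewrite Rabs_pos_eq; lra. }
destruct He as [s Hs].
exists (s + x 0%nat).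
apply is_lim_seq_incr_1.
apply is_lim_seq_ext with
  (fun n => sum_n (fun j => x (S j) - x j) n + x 0%nat).
- intros n. induction n as [|n IH].
  + rewrite sum_O. ring.
  + rewrite sum_Sn. unfold plus; simpl. lra.
- apply is_lim_seq_plus'; [exact Hs | apply is_lim_seq_const].
Qed.

Lemma Cmod_sub_sym (p q : C) : Cmod (p - q) = Cmod (q - p).
Proof. rewrite <- Cmod_opp. f_equal. ring. Qed.

Lemma Cmod_sub_triangle (p q s : C) : Cmod (p - s) <= Cmod (p - q) + Cmod (q - s).
Proof. replace (p - s)%C with ((p - q) + (q - s))%C by ring. apply Cmod_triangle. Qed.

Lemma Rabs_fst_sub_le_Cmod (p q : C) : Rabs (fst p - fst q) <= Cmod (p - q).
Proof. eapply Rle_trans; [apply Rmax_l | apply (Rmax_Cmod (p - q)%C)]. Qed.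

Lemma Rabs_snd_sub_le_Cmod (p q : C) : Rabs (snd p - snd q) <= Cmod (p - q).
Proof. eapply Rle_trans; [apply Rmax_r | apply (Rmax_Cmod (p - q)%C)]. Qed.

(** Contraction estimates live in the Euclidean norm, differentiability in the max norm; the sharp
    factor [sqrt 2] is rounded up to [2]. *)
Lemma Cmod_sub_le_Rmax (p q : C) :
  Cmod (p - q) <= 2 * Rmax (Rabs (fst p - fst q)) (Rabs (snd p - snd q)).
Proof.
eapply Rle_trans; [apply Cmod_2Rmax|].
apply Rmult_le_compat_r.
- eapply Rle_trans; [apply Rabs_pos | apply Rmax_l].
- rewrite <- (sqrt_pow2 2) at 2 by lra. apply sqrt_le_1; lra.
Qed.

(** Picard iteration from the centre. The bound on [T p0 - p0] keeps the iterates in the ball, since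
    [L * r + (1 - L) * r = r], so the contraction property on the ball suffices. *)
Lemma contraction_on_ball_fixpoint (T : C -> C) (p0 : C) (r L : R) :
  0 <= L < 1 ->
  (forall p q, Cmod (p - p0) <= r -> Cmod (q - p0) <= r ->
     Cmod (T p - T q) <= L * Cmod (p - q)) ->
  Cmod (T p0 - p0) <= (1 - L) * r ->
  exists p, Cmod (p - p0) <= r /\ T p = p.
Proof.
intros HL HT H0.
set (d := Cmod (T p0 - p0)) in *.
set (x := fun n => Nat.iter n T p0).
assert (Hd : 0 <= d) by apply Cmod_ge_0.
assert (Hr : 0 <= r) by nra.
assert (Hball : forall n, Cmod (x n - p0) <= r).
{ induction n as [|n IH].
  - change (x 0%nat) with p0. replace (p0 - p0)%C with (RtoC 0) by ring.
    rewrite Cmod_0. lra.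
  - change (x (S n)) with (T (x n)).
    pose proof (Cmod_sub_triangle (T (x n)) (T p0) p0).
    assert (Cmod (p0 - p0) <= r).
    { replace (p0 - p0)%C with (RtoC 0) by ring. rewrite Cmod_0. lra. }
    pose proof (HT (x n) p0 IH H1). fold d in H. nra. }
assert (Hinc : forall n, Cmod (x (S n) - x n) <= L ^ n * d).
{ induction n as [|n IH].
  - change (x 1%nat) with (T p0). change (x 0%nat) with p0. fold d. simpl. lra.
  - change (x (S (S n)) - x (S n))%C with (T (x (S n)) - T (x n))%C.
    pose proof (HT (x (S n)) (x n) (Hball (S n)) (Hball n)).
    simpl pow. nra. }
destruct (ex_lim_seq_of_geometric_increments (fun n => fst (x n)) L d HL) as [l1 Hl1].
{ intros n. eapply Rle_trans; [apply Rabs_fst_sub_le_Cmod | apply Hinc]. }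
destruct (ex_lim_seq_of_geometric_increments (fun n => snd (x n)) L d HL) as [l2 Hl2].
{ intros n. eapply Rle_trans; [apply Rabs_snd_sub_le_Cmod | apply Hinc]. }
set (l := (l1, l2) : C).
assert (Hconv : forall eps, 0 < eps ->
  exists n, Cmod (x n - l) < eps /\ Cmod (x (S n) - l) < eps).
{ intros eps Heps.
  apply is_lim_seq_spec in Hl1. apply is_lim_seq_spec in Hl2.
  destruct (Hl1 (mkposreal (eps / 2) ltac:(lra))) as [N1 HN1].
  destruct (Hl2 (mkposreal (eps / 2) ltac:(lra))) as [N2 HN2].
  simpl in HN1, HN2.
  assert (Hn : forall n, (N1 + N2 <= n)%nat -> Cmod (x n - l) < eps).
  { intros n Hn. eapply Rle_lt_trans; [apply Cmod_sub_le_Rmax|].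
    specialize (HN1 n ltac:(lia)). specialize (HN2 n ltac:(lia)).
    assert (Rmax (Rabs (fst (x n) - fst l)) (Rabs (snd (x n) - snd l)) < eps / 2)
      by (apply Rmax_lub_lt; assumption).
    lra. }
  exists (N1 + N2)%nat. split; apply Hn; lia. }
assert (Hl : Cmod (l - p0) <= r).
{ apply le_epsilon. intros eps Heps.
  destruct (Hconv eps Heps) as [n [Hn _]].
  pose proof (Cmod_sub_triangle l (x n) p0). rewrite Cmod_sub_sym in Hn.
  pose proof (Hball n). lra. }
exists l. split; [exact Hl|].
(* [T l] is within [eps / 2] of [x (S n)] by contraction, and [x (S n)] is within [eps / 2] of
   [l]. *)
assert (Hz : Cmod (T l - l) <= 0).
{ apply le_epsilon. intros eps Heps.
  destruct (Hconv (eps / 2) ltac:(lra)) as [n [Hn Hn']].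
  pose proof (Cmod_sub_triangle (T l) (T (x n)) l) as Htri.
  pose proof (HT l (x n) Hl (Hball n)) as HTl.
  rewrite Cmod_sub_sym in Hn. change (T (x n)) with (x (S n)) in *.
  pose proof (Cmod_ge_0 (l - x n)). nra. }
assert (Heq : (T l - l = 0)%C).
{ apply Cmod_eq_0. apply Rle_antisym; [exact Hz | apply Cmod_ge_0]. }
replace (T l) with ((T l - l) + l)%C by ring. rewrite Heq. ring.
Qed.

(** * Differentiability of a Lipschitz inverse *)

(** Terms with zero differential at the base point do not affect the linear part. A Lipschitz
    inverse takes this form once its linearization is solved. *)
Lemma differentiable_pt_lim_affine_perturbation (r s : R -> R -> R)
  (x y e a b p q : R) :
  differentiable_pt_lim r x y 0 0 -> differentiable_pt_lim s x y 0 0 ->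
  differentiable_pt_lim
    (fun u v => e + a * (u - x) + b * (v - y) + p * r u v + q * s u v) x y a b.
Proof.
intros Hr Hs eps.
set (w := Rabs p + Rabs q + 1).
assert (Hw : 0 < w) by (pose proof (Rabs_pos p); pose proof (Rabs_pos q); unfold w; lra).
assert (He : 0 < eps / w) by (apply Rdiv_lt_0_compat; [apply cond_pos | exact Hw]).
destruct (Hr (mkposreal _ He)) as [d1 Hd1].
destruct (Hs (mkposreal _ He)) as [d2 Hd2].
assert (Hd : 0 < Rmin d1 d2) by (apply Rmin_pos; apply cond_pos).
exists (mkposreal _ Hd). simpl. intros u v Hu Hv.
pose proof (Rmin_l d1 d2). pose proof (Rmin_r d1 d2).
specialize (Hd1 u v ltac:(lra) ltac:(lra)).
specialize (Hd2 u v ltac:(lra) ltac:(lra)). simpl in Hd1, Hd2.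
set (N := Rmax _ _) in *.
rewrite !Rmult_0_l, Rplus_0_r, Rminus_0_r in Hd1, Hd2.
match goal with |- Rabs ?z <= _ =>
  replace z with (p * (r u v - r x y) + q * (s u v - s x y)) by ring end.
eapply Rle_trans; [apply Rabs_triang|]. rewrite !Rabs_mult.
set (n := eps / w * N) in *.
replace (eps * N) with (w * n) by (unfold n; field; lra).
pose proof (Rabs_pos p). pose proof (Rabs_pos q).
pose proof (Rabs_pos (r u v - r x y)).
unfold w. nra.
Qed.

(** The linearization error of [F] is small relative to the increment of [(A, B)], which the
    Lipschitz bound controls by that of [(u, v)]. Differentiability of [A] and [B] is not
    presupposed. *)
Lemma remainder_comp_Lipschitz (F A B : R -> R -> R) (x y K Fa Fb : R) :
  differentiable_pt_lim F (A x y) (B x y) Fa Fb ->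
  locally_2d (fun u v => Rmax (Rabs (A u v - A x y)) (Rabs (B u v - B x y))
                          <= K * Rmax (Rabs (u - x)) (Rabs (v - y))) x y ->
  differentiable_pt_lim
    (fun u v => F (A u v) (B u v) - (Fa * (A u v - A x y) + Fb * (B u v - B x y)))
    x y 0 0.
Proof.
intros HF [d2 Hlip] eps.
(* The sign of [K] is arbitrary; [Rmax K 1] is a positive Lipschitz constant that can be divided
   by. *)
assert (HK1 : 1 <= Rmax K 1) by apply Rmax_r.
assert (He : 0 < eps / Rmax K 1) by (apply Rdiv_lt_0_compat; [apply cond_pos | lra]).
destruct (HF (mkposreal _ He)) as [dF HdF]. simpl in HdF.
pose (d3 := dF / Rmax K 1).
assert (Hd3 : 0 < d3) by (apply Rdiv_lt_0_compat; [apply cond_pos | lra]).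
assert (Hd : 0 < Rmin d2 d3) by (apply Rmin_pos; [apply cond_pos | exact Hd3]).
exists (mkposreal _ Hd). simpl. intros u v Hu Hv.
pose proof (Rmin_l d2 d3). pose proof (Rmin_r d2 d3).
assert (H1 := Hlip u v ltac:(lra) ltac:(lra)).
assert (Hm : Rmax (Rabs (u - x)) (Rabs (v - y)) < d3) by (apply Rmax_lub_lt; lra).
assert (Hm0 : 0 <= Rmax (Rabs (u - x)) (Rabs (v - y)))
  by (eapply Rle_trans; [apply Rabs_pos | apply Rmax_l]).
set (N := Rmax (Rabs (u - x)) (Rabs (v - y))) in *.
assert (H2 : Rmax (Rabs (A u v - A x y)) (Rabs (B u v - B x y)) <= Rmax K 1 * N).
{ eapply Rle_trans; [exact H1|]. apply Rmult_le_compat_r; [lra | apply Rmax_l]. }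
assert (H3 : Rmax (Rabs (A u v - A x y)) (Rabs (B u v - B x y)) < dF).
{ eapply Rle_lt_trans; [exact H2|].
  replace (pos dF) with (Rmax K 1 * d3) by (unfold d3; field; lra).
  apply Rmult_lt_compat_l; lra. }
pose proof (Rmax_l (Rabs (A u v - A x y)) (Rabs (B u v - B x y))).
pose proof (Rmax_r (Rabs (A u v - A x y)) (Rabs (B u v - B x y))).
replace (eps * N) with (eps / Rmax K 1 * (Rmax K 1 * N)) by (field; lra).
eapply Rle_trans; [|apply Rmult_le_compat_l; [lra | exact H2]].
eapply Rle_trans; [|apply HdF; lra].
right. f_equal. ring.
Qed.

(** Since [F (A, B) = u] and [G (A, B) = v], the two remainders give a linear system for the
    increments of [A] and [B]; Cramer's rule writes these as affine functions plus combinations of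
    the remainders. *)
Lemma differentiable_pt_lim_inverse (F G A B : R -> R -> R)
  (x y K Fa Fb Ga Gb : R) :
  let D := Fa * Gb - Fb * Ga in
  D <> 0 ->
  differentiable_pt_lim F (A x y) (B x y) Fa Fb ->
  differentiable_pt_lim G (A x y) (B x y) Ga Gb ->
  locally_2d (fun u v => F (A u v) (B u v) = u /\ G (A u v) (B u v) = v) x y ->
  locally_2d (fun u v => Rmax (Rabs (A u v - A x y)) (Rabs (B u v - B x y))
                          <= K * Rmax (Rabs (u - x)) (Rabs (v - y))) x y ->
  differentiable_pt_lim A x y (Gb / D) (- Fb / D) /\
  differentiable_pt_lim B x y (- Ga / D) (Fa / D).
Proof.
intros D HD HF HG Hinv Hlip.
pose proof (remainder_comp_Lipschitz F A B x y K Fa Fb HF Hlip) as Hr.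
pose proof (remainder_comp_Lipschitz G A B x y K Ga Gb HG Hlip) as Hs.
split.
(* The constant [(Gb * x - Fb * y) / D] appears because the remainders take the values [x] and [y],
   not zero, at the base point. *)
- eapply differentiable_pt_lim_ext;
    [|apply (differentiable_pt_lim_affine_perturbation _ _ x y
       (A x y + (Gb * x - Fb * y) / D) (Gb / D) (- Fb / D) (- Gb / D) (Fb / D) Hr Hs)].
  destruct Hinv as [d Hd]. exists d. intros u v Hu Hv.
  destruct (Hd u v Hu Hv) as [-> ->]. unfold D in *. field. exact HD.
- eapply differentiable_pt_lim_ext;
    [|apply (differentiable_pt_lim_affine_perturbation _ _ x y
       (B x y + (Fa * y - Ga * x) / D) (- Ga / D) (Fa / D) (Ga / D) (- Fa / D) Hr Hs)].
  destruct Hinv as [d Hd]. exists d. intros u v Hu Hv.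
  destruct (Hd u v Hu Hv) as [-> ->]. unfold D in *. field. exact HD.
Qed.

(** * The trochoidal map and its inverse *)

(** This family contains both coordinates of the trochoidal map and, in terms of phase and depth,
    both velocity components. *)
Lemma affine_add_exp_trig_differentiable (k r p q x y a b : R) :
  differentiable_pt_lim
    (fun a b => r + p * a + q * b + exp (k * b) * (x * cos (k * a) + y * sin (k * a))) a b
    (p + k * exp (k * b) * (y * cos (k * a) - x * sin (k * a)))
    (q + k * exp (k * b) * (x * cos (k * a) + y * sin (k * a))).
Proof.
apply filterdiff_differentiable_pt_lim.
apply (is_derive_filterdiff
  (fun a b => r + p * a + q * b + exp (k * b) * (x * cos (k * a) + y * sin (k * a))) a b
  (fun a b => p + k * exp (k * b) * (y * cos (k * a) - x * sin (k * a)))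
  (q + k * exp (k * b) * (x * cos (k * a) + y * sin (k * a)))).
- apply filter_forall. intros [a' b']. simpl. auto_derive; [trivial|]. ring.
- auto_derive; [trivial|]. ring.
- apply (continuity_2d_pt_filterlim
    (fun a b => p + k * exp (k * b) * (y * cos (k * a) - x * sin (k * a)))).
  assert (Hka : continuity_2d_pt (fun a _ => k * a) a b).
  { apply continuity_2d_pt_mult; [apply continuity_2d_pt_const | apply continuity_2d_pt_id1]. }
  apply continuity_2d_pt_plus; [apply continuity_2d_pt_const|].
  apply continuity_2d_pt_mult.
  + apply continuity_2d_pt_mult; [apply continuity_2d_pt_const|].
    apply (continuity_1d_2d_pt_comp exp (fun _ b => k * b)).
    * apply derivable_continuous_pt, derivable_pt_exp.
    * apply continuity_2d_pt_mult; [apply continuity_2d_pt_const | apply continuity_2d_pt_id2].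
  + apply continuity_2d_pt_minus; apply continuity_2d_pt_mult;
      try apply continuity_2d_pt_const.
    * apply (continuity_1d_2d_pt_comp cos (fun a _ => k * a)); [apply continuity_cos | exact Hka].
    * apply (continuity_1d_2d_pt_comp sin (fun a _ => k * a)); [apply continuity_sin | exact Hka].
Qed.

Definition trochoid_x (k a b : R) : R := a - exp (k * b) / k * sin (k * a).
Definition trochoid_z (k a b : R) : R := b + exp (k * b) / k * cos (k * a).

Lemma trochoid_x_differentiable (k a b : R) : 0 < k ->
  differentiable_pt_lim (trochoid_x k) a b
    (1 - exp (k * b) * cos (k * a)) (- (exp (k * b) * sin (k * a))).
Proof.
intros Hk.
pose proof (affine_add_exp_trig_differentiable k 0 1 0 0 (- / k) a b) as H.
match type of H with differentiable_pt_lim _ _ _ ?l1 ?l2 =>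
  replace (1 - _) with l1 by (field; lra); replace (- (_ * _)) with l2 by (field; lra) end.
eapply differentiable_pt_lim_ext; [|exact H].
apply locally_2d_forall. intros u v. unfold trochoid_x. field. lra.
Qed.

Lemma trochoid_z_differentiable (k a b : R) : 0 < k ->
  differentiable_pt_lim (trochoid_z k) a b
    (- (exp (k * b) * sin (k * a))) (1 + exp (k * b) * cos (k * a)).
Proof.
intros Hk.
pose proof (affine_add_exp_trig_differentiable k 0 0 1 (/ k) 0 a b) as H.
match type of H with differentiable_pt_lim _ _ _ ?l1 ?l2 =>
  replace (1 + _) with l2 by (field; lra); replace (- (_ * _)) with l1 by (field; lra) end.
eapply differentiable_pt_lim_ext; [|exact H].
apply locally_2d_forall. intros u v. unfold trochoid_z. field. lra.
Qed.

(** * Lipschitz and expansion estimates for the trochoidal map *)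

Lemma one_sub_cos_le (x : R) : 1 - cos x <= x ^ 2 / 2.
Proof.
assert (Hpos : forall y, 0 <= y -> 1 - cos y <= y ^ 2 / 2).
{ intros y Hy. destruct (Req_dec y 0) as [->|Hne]; [rewrite cos_0; lra|].
  replace (cos y) with (cos (2 * (y / 2))) by (f_equal; field).
  rewrite cos_2a_sin.
  assert (H : Rabs (sin (y / 2)) <= y / 2).
  { apply Rabs_le. split; [|left; apply sin_lt_x; lra].
    destruct (Rle_dec (y / 2) PI) as [H|H].
    - pose proof (sin_ge_0 (y / 2) ltac:(lra) H). lra.
    - pose proof (SIN_bound (y / 2)). pose proof PI2_1. lra. }
  apply pow_maj_Rabs with (n := 2%nat) in H. nra. }
destruct (Rle_dec 0 x) as [H|H]; [apply Hpos, H|].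
rewrite <- (cos_neg x). replace (x ^ 2) with ((- x) ^ 2) by ring. apply Hpos; lra.
Qed.

(** The tangent line bound [1 + s <= exp s] replaces the mean value theorem. Squares make the claim
    symmetric in [x] and [y] and match the squared modulus. *)
Lemma exp_sub_sqr_le (x y z : R) : x <= z -> y <= z ->
  (exp x - exp y) ^ 2 <= (exp z * (x - y)) ^ 2.
Proof.
assert (Hle : forall x y, x <= y -> y <= z -> (exp x - exp y) ^ 2 <= (exp z * (x - y)) ^ 2).
{ clear x y. intros x y Hxy Hyz.
  assert (H1 : exp y - exp x <= exp y * (y - x)).
  { replace (exp x) with (exp y * exp (x - y)) by (rewrite <- exp_plus; f_equal; ring).
    pose proof (exp_ineq1_le (x - y)). pose proof (exp_pos y). nra. }
  assert (H0 : exp x <= exp y) by (destruct Hxy as [Hxy| ->]; [left; apply exp_increasing, Hxy | lra]).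
  assert (H2 : exp y <= exp z) by (destruct Hyz as [Hyz| ->]; [left; apply exp_increasing, Hyz | lra]).
  assert (H3 : exp y - exp x <= exp z * (y - x)) by nra.
  replace ((exp x - exp y) ^ 2) with ((exp y - exp x) ^ 2) by ring.
  replace ((exp z * (x - y)) ^ 2) with ((exp z * (y - x)) ^ 2) by ring.
  apply pow_incr. lra. }
intros Hx Hy. destruct (Rle_dec x y) as [H|H]; [apply Hle; assumption|].
replace ((exp x - exp y) ^ 2) with ((exp y - exp x) ^ 2) by ring.
replace (x - y) with (- (y - x)) by ring.
replace ((exp z * - (y - x)) ^ 2) with ((exp z * (y - x)) ^ 2) by ring.
apply Hle; lra.
Qed.

Definition trochoid (k : R) (p : C) : C :=
  (trochoid_x k (fst p) (snd p), trochoid_z k (fst p) (snd p)).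

(** The displacement has length [exp (k * b) / k] and an angle growing at rate [k] in [a]. The
    radial part of a difference is bounded by [exp_sub_sqr_le], the angular part by
    [one_sub_cos_le]. *)
Lemma trochoid_perturbation_Lipschitz (k beta : R) (p q : C) :
  0 < k -> snd p <= beta -> snd q <= beta ->
  Cmod ((trochoid k p - p) - (trochoid k q - q)) <= exp (k * beta) * Cmod (p - q).
Proof.
destruct p as [a b], q as [a' b']; simpl. intros Hk Hb Hb'.
unfold Cmod. rewrite <- (sqrt_pow2 (exp (k * beta))) by (left; apply exp_pos).
rewrite <- sqrt_mult_alt by apply pow2_ge_0.
apply sqrt_le_1_alt. simpl fst; simpl snd. unfold trochoid_x, trochoid_z.
assert (He := exp_sub_sqr_le (k * b) (k * b') (k * beta) ltac:(nra) ltac:(nra)).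
assert (H1 : exp (k * b) <= exp (k * beta))
  by (destruct Hb as [Hb| ->]; [left; apply exp_increasing; nra | lra]).
assert (H2 : exp (k * b') <= exp (k * beta))
  by (destruct Hb' as [Hb'| ->]; [left; apply exp_increasing; nra | lra]).
pose proof (exp_pos (k * b)). pose proof (exp_pos (k * b')).
set (E := exp (k * b)) in *. set (E' := exp (k * b')) in *. set (L := exp (k * beta)) in *.
assert (Hc := one_sub_cos_le (k * a - k * a')). rewrite cos_minus in Hc.
pose proof (sin2_cos2 (k * a)) as Hs. pose proof (sin2_cos2 (k * a')) as Hs'.
unfold Rsqr in Hs, Hs'.
set (ca := cos (k * a)) in *. set (sa := sin (k * a)) in *.
set (ca' := cos (k * a')) in *. set (sa' := sin (k * a')) in *.
assert (HEE : E * E' <= L ^ 2) by nra.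
apply Rmult_le_reg_l with (k ^ 2); [nra|].
(* The two displaced vectors have lengths [E/k] and [E'/k] and make the angle
   [k (a - a')], so the law of cosines applies. *)
replace (k ^ 2 * _) with ((E - E') ^ 2 * 1 + 2 * (E * E') * (1 - (ca * ca' + sa * sa'))).
2:{ transitivity ((E ^ 2 * (sa * sa + ca * ca) + E' ^ 2 * (sa' * sa' + ca' * ca')
       - 2 * (E * E') * (ca * ca' + sa * sa'))).
    - rewrite Hs, Hs'. ring.
    - field. lra. }
assert (2 * (E * E') * (1 - (ca * ca' + sa * sa')) <= L ^ 2 * (k * a - k * a') ^ 2).
{ assert (0 < E * E') by nra.
  assert (0 <= (k * a - k * a') ^ 2) by apply pow2_ge_0. nra. }
nra.
Qed.

(** Reverse triangle inequality for the identity plus a Lipschitz perturbation. *)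
Lemma trochoid_expansive (k beta : R) (p q : C) :
  0 < k -> snd p <= beta -> snd q <= beta ->
  (1 - exp (k * beta)) * Cmod (p - q) <= Cmod (trochoid k p - trochoid k q).
Proof.
intros Hk Hp Hq.
pose proof (trochoid_perturbation_Lipschitz k beta p q Hk Hp Hq) as H.
pose proof (Cmod_triangle (trochoid k p - trochoid k q)
  (- ((trochoid k p - p) - (trochoid k q - q)))) as Ht.
rewrite Cmod_opp in Ht.
replace (trochoid k p - trochoid k q + - (trochoid k p - p - (trochoid k q - q)))%C
  with (p - q)%C in Ht by ring.
lra.
Qed.

Lemma exp_mul_lt_1 (k b : R) : 0 < k -> b < 0 -> exp (k * b) < 1.
Proof. intros Hk Hb. rewrite <- exp_0. apply exp_increasing. nra. Qed.

Lemma trochoid_injective (k : R) (p q : C) :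
  0 < k -> snd p < 0 -> snd q < 0 -> trochoid k p = trochoid k q -> p = q.
Proof.
intros Hk Hp Hq Heq.
(* The contraction constant tends to [1] as [b] tends to [0], so the half-plane is adapted to the
   two points. *)
assert (Hb : Rmax (snd p) (snd q) < 0) by (apply Rmax_lub_lt; assumption).
pose proof (trochoid_expansive k _ p q Hk (Rmax_l _ _) (Rmax_r _ _)) as H.
pose proof (exp_mul_lt_1 k _ Hk Hb).
rewrite Heq in H. replace (trochoid k q - trochoid k q)%C with (RtoC 0) in H by ring.
rewrite Cmod_0 in H.
assert (Hpq : (p - q = 0)%C) by (apply Cmod_eq_0; pose proof (Cmod_ge_0 (p - q)); nra).
replace p with ((p - q) + q)%C by ring. rewrite Hpq. ring.
Qed.

(* A preimage of [q] is a fixed point of [p |-> q - (trochoid k p - p)], which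
   is a contraction on every half-plane [b <= beta < 0]. *)
Lemma trochoid_locally_surjective (k beta : R) (p0 q : C) :
  0 < k -> beta < 0 ->
  Cmod (q - trochoid k p0) <= (1 - exp (k * beta)) * (beta - snd p0) ->
  exists p, snd p <= beta /\ trochoid k p = q.
Proof.
intros Hk Hbeta Hq.
(* The radius [beta - snd p0] keeps the ball inside the half-plane [b <= beta]. *)
destruct (contraction_on_ball_fixpoint (fun p => q - (trochoid k p - p))%C p0
  (beta - snd p0) (exp (k * beta))) as [p [Hp Hfix]].
- split; [left; apply exp_pos | apply exp_mul_lt_1; assumption].
- assert (Hball : forall p, Cmod (p - p0) <= beta - snd p0 -> snd p <= beta).
  { intros p Hp. pose proof (Rabs_snd_sub_le_Cmod p p0).
    pose proof (Rle_abs (snd p - snd p0)). lra. }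
  intros p s Hp Hs. rewrite Cmod_sub_sym.
  replace (q - (trochoid k s - s) - (q - (trochoid k p - p)))%C
    with ((trochoid k p - p) - (trochoid k s - s))%C by ring.
  apply trochoid_perturbation_Lipschitz; auto.
- replace (q - (trochoid k p0 - p0) - p0)%C with (q - trochoid k p0)%C by ring. exact Hq.
- exists p. split.
  + pose proof (Rabs_snd_sub_le_Cmod p p0). pose proof (Rle_abs (snd p - snd p0)). lra.
  + transitivity (q - (q - (trochoid k p - p)) + p)%C; [ring|].
    rewrite Hfix. ring.
Qed.

Definition trochoid_inv (k b0 : R) (q : C) : C :=
  epsilon (inhabits (0, 0)) (fun p => snd p < b0 /\ trochoid k p = q).

Lemma trochoid_inv_trochoid (k b0 : R) (p : C) :
  0 < k -> b0 <= 0 -> snd p < b0 -> trochoid_inv k b0 (trochoid k p) = p.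
Proof.
intros Hk Hb0 Hp.
destruct (epsilon_spec (inhabits (0, 0))
  (fun s => snd s < b0 /\ trochoid k s = trochoid k p)
  (ex_intro _ p (conj Hp eq_refl))) as [H1 H2].
apply (trochoid_injective k); [exact Hk | | lra | exact H2].
unfold trochoid_inv. lra.
Qed.

(** Near an image point the chosen preimage exists, is a right inverse and obeys a Lipschitz bound:
    the data required by [differentiable_pt_lim_inverse]. *)
Lemma trochoid_inv_locally (k b0 : R) (p0 : C) :
  0 < k -> b0 <= 0 -> snd p0 < b0 ->
  exists K, locally_2d (fun x z =>
      snd (trochoid_inv k b0 (x, z)) < b0 /\
      trochoid k (trochoid_inv k b0 (x, z)) = (x, z) /\
      Rmax (Rabs (fst (trochoid_inv k b0 (x, z)) - fst p0))
           (Rabs (snd (trochoid_inv k b0 (x, z)) - snd p0))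
        <= K * Rmax (Rabs (x - fst (trochoid k p0))) (Rabs (z - snd (trochoid k p0))))
    (fst (trochoid k p0)) (snd (trochoid k p0)).
Proof.
intros Hk Hb0 Hp0.
(* The midpoint leaves room above [p0] for nearby preimages and keeps them strictly below [b0]. *)
pose (beta := (snd p0 + b0) / 2).
assert (Hbeta : beta < b0) by (unfold beta; lra).
assert (HL : exp (k * beta) < 1) by (apply exp_mul_lt_1; lra).
set (L := exp (k * beta)) in *.
assert (Hd : 0 < (1 - L) * (beta - snd p0) / 2)
  by (apply Rdiv_lt_0_compat; [apply Rmult_lt_0_compat; unfold beta; lra | lra]).
(* Expansiveness gives [1 / (1 - L)]; the [2], like the halving in the radius, pays for passing
   between the norms. *)
exists (2 / (1 - L)), (mkposreal _ Hd). simpl. intros x z Hx Hz.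
pose proof (Cmod_sub_le_Rmax (x, z) (trochoid k p0)) as Hq. simpl in Hq.
set (N := Rmax _ _) in *.
assert (HN : N < (1 - L) * (beta - snd p0) / 2) by (apply Rmax_lub_lt; assumption).
destruct (trochoid_locally_surjective k beta p0 (x, z) Hk ltac:(lra)) as [p [Hpb Hp]].
{ fold L. simpl in *. lra. }
rewrite <- Hp, trochoid_inv_trochoid by lra.
split; [lra | split; [reflexivity|]].
eapply Rle_trans; [apply (Rmax_Cmod (p - p0)%C)|].
pose proof (trochoid_expansive k beta p p0 Hk Hpb ltac:(unfold beta; lra)) as He.
fold L in He. rewrite Hp in He.
apply Rmult_le_reg_l with (1 - L); [lra|].
replace ((1 - L) * (2 / (1 - L) * N)) with (2 * N) by (field; lra).
eapply Rle_trans; [exact He | exact Hq].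
Qed.

(** The Jacobian matrix of [trochoid] is symmetric with determinant [1 - e ^ 2], positive because
    [b < 0]; the stated entries are those of its inverse. *)
Lemma trochoid_inv_differentiable (k b0 : R) (p0 : C) :
  0 < k -> b0 <= 0 -> snd p0 < b0 ->
  let e := exp (k * snd p0) in
  let co := cos (k * fst p0) in
  let si := sin (k * fst p0) in
  let x := fst (trochoid k p0) in
  let z := snd (trochoid k p0) in
  differentiable_pt_lim (fun x z => fst (trochoid_inv k b0 (x, z))) x z
    ((1 + e * co) / (1 - e ^ 2)) (e * si / (1 - e ^ 2)) /\
  differentiable_pt_lim (fun x z => snd (trochoid_inv k b0 (x, z))) x z
    (e * si / (1 - e ^ 2)) ((1 - e * co) / (1 - e ^ 2)).
Proof.
intros Hk Hb0 Hp0 e co si x z.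
assert (Hinv : trochoid_inv k b0 (x, z) = p0).
{ unfold x, z. rewrite <- surjective_pairing. apply trochoid_inv_trochoid; assumption. }
assert (He : 0 < e < 1) by (split; [apply exp_pos | apply exp_mul_lt_1; lra]).
destruct (trochoid_inv_locally k b0 p0 Hk Hb0 Hp0) as [K HK].
fold x z in HK.
assert (HD : (1 - e * co) * (1 + e * co) - - (e * si) * - (e * si) = 1 - e ^ 2).
{ pose proof (sin2_cos2 (k * fst p0)) as H. fold co si in H. unfold Rsqr in H.
  transitivity (1 - e ^ 2 * (si * si + co * co)); [ring | rewrite H; ring]. }
pose proof (differentiable_pt_lim_inverse (trochoid_x k) (trochoid_z k)
  (fun x z => fst (trochoid_inv k b0 (x, z))) (fun x z => snd (trochoid_inv k b0 (x, z)))
  x z K (1 - e * co) (- (e * si)) (- (e * si)) (1 + e * co)) as H.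
simpl in H. rewrite HD, Hinv, !Ropp_involutive in H.
apply H.
- nra.
- apply trochoid_x_differentiable, Hk.
- apply trochoid_z_differentiable, Hk.
- destruct HK as [d HK]. exists d. intros u v Hu Hv.
  destruct (HK u v Hu Hv) as [_ [Heq _]].
  unfold trochoid in Heq. injection Heq. auto.
- destruct HK as [d HK]. exists d. intros u v Hu Hv. apply HK; assumption.
Qed.

(** * Fields steady in the moving frame *)

(* In the frame moving with the wave, [Phi t] is the time-independent map
   [trochoid], the label [a] becoming the phase [a - m t]. *)
Lemma Phi_trochoid (k m c t a b : R) :
  Phi k m c t (a, b) =
    (fst (trochoid k (a - m * t, b)) + c * t, snd (trochoid k (a - m * t, b))).
Proof.
unfold Phi, Xpath, Zpath, trochoid, trochoid_x, trochoid_z; simpl.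
f_equal; ring.
Qed.

(** Injectivity forces the choice made by [epsilon]. Evaluated at these points, the velocity and
    pressure depend only on phase and depth, not on [t]. *)
Lemma Phi_inv_trochoid (k m c b0 t : R) (p : C) :
  0 < k -> b0 <= 0 -> snd p < b0 ->
  Phi_inv k m c b0 t (fst (trochoid k p) + c * t, snd (trochoid k p))
    = (fst p + m * t, snd p).
Proof.
intros Hk Hb0 Hp. unfold Phi_inv.
set (Q := fun ab => Sigma b0 ab /\ _).
assert (Hex : Q (fst p + m * t, snd p)).
{ split; [exact Hp|]. rewrite Phi_trochoid.
  replace (fst p + m * t - m * t) with (fst p) by ring.
  rewrite <- surjective_pairing. reflexivity. }
destruct (epsilon_spec (inhabits (0, 0)) Q (ex_intro _ _ Hex)) as [Hb H].
destruct (epsilon _ Q) as [a b]. unfold Sigma in Hb. simpl in Hb.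
rewrite Phi_trochoid in H.
assert (Heq : (a - m * t, b) = p).
{ apply (trochoid_injective k); [exact Hk | simpl; lra | lra |].
  apply injective_projections; injection H; intros; simpl in *; lra. }
rewrite <- Heq. simpl. f_equal. ring.
Qed.

Lemma Derive_Xpath (k m c t a b : R) : 0 < k ->
  Derive (fun s => Xpath k m c s a b) t
    = c - m + m * exp (k * b) * cos (k * (a - m * t)).
Proof.
intros Hk. apply is_derive_unique. unfold Xpath. auto_derive; [trivial|]. unfold Rminus. field. lra.
Qed.

Lemma Derive_Zpath (k m t a b : R) : 0 < k ->
  Derive (fun s => Zpath k m s a b) t = m * exp (k * b) * sin (k * (a - m * t)).
Proof.
intros Hk. apply is_derive_unique. unfold Zpath. auto_derive; [trivial|]. unfold Rminus. field. lra.
Qed.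

Lemma travelling_wave_derivatives (V : R -> R -> R -> R) (f : R -> R -> R)
  (c t X Z lx lz : R) :
  differentiable_pt_lim f (X - c * t) Z lx lz ->
  locally_2d (fun x z => forall s, V s (x + c * s) z = f x z) (X - c * t) Z ->
  is_derive (fun s => V s X Z) t (- c * lx) /\
  is_derive (fun x => V t x Z) X lx /\
  is_derive (fun z => V t X z) Z lz.
Proof.
intros Hf HV.
(* One chain rule along a curve [(x s, z s)] in the moving frame serves all three slices: the
   auxiliary time [r] is [s] for the time derivative and the fixed [t] for the spatial ones. *)
assert (Hline : forall (x z : R -> R) (h : R -> R) (s0 dx dz : R),
  x s0 = X - c * t -> z s0 = Z ->
  is_derive x s0 dx -> is_derive z s0 dz ->
  (forall s, exists r, h s = V r (x s + c * r) (z s)) ->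
  is_derive h s0 (lx * dx + lz * dz)).
{ intros x z h s0 dx dz Hx0 Hz0 Hx Hz Hh.
  apply is_derive_ext_loc with (fun s => f (x s) (z s)).
  - destruct HV as [d HV].
    assert (Hcx : locally s0 (fun s => Rabs (x s - x s0) < d))
      by exact (ex_derive_continuous x s0 (ex_intro _ _ Hx) _ (locally_ball _ d)).
    assert (Hcz : locally s0 (fun s => Rabs (z s - z s0) < d))
      by exact (ex_derive_continuous z s0 (ex_intro _ _ Hz) _ (locally_ball _ d)).
    generalize (filter_and _ _ Hcx Hcz).
    apply filter_imp. intros s [H1 H2]. destruct (Hh s) as [r ->].
    symmetry. apply HV; [rewrite <- Hx0; exact H1 | rewrite <- Hz0; exact H2].
  - apply is_derive_Reals. apply derivable_pt_lim_comp_2d.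
    + rewrite Hx0, Hz0. exact Hf.
    + apply is_derive_Reals, Hx.
    + apply is_derive_Reals, Hz. }
split; [|split].
- replace (- c * lx) with (lx * - c + lz * 0) by ring.
  apply Hline with (fun s => X - c * s) (fun _ => Z); try reflexivity.
  + auto_derive; [trivial | ring].
  + auto_derive; [trivial | ring].
  + intros s. exists s. f_equal. ring.
- replace lx with (lx * 1 + lz * 0) by ring.
  apply Hline with (fun x => x - c * t) (fun _ => Z); try reflexivity.
  + auto_derive; [trivial | ring].
  + auto_derive; [trivial | ring].
  + intros s. exists t. f_equal. ring.
- replace lz with (lx * 0 + lz * 1) by ring.
  apply Hline with (fun _ => X - c * t) (fun z => z); try reflexivity.
  + auto_derive; [trivial | ring].
  + auto_derive; [trivial | ring].
  + intros s. exists t. f_equal. ring.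
Qed.

(** The formulas for the fields make sense at all real times, so a two-sided derivative is available
    even at [t = 0] and restricts to the half-line. *)
Lemma is_derive_is_time_derive (f : R -> R) (t l : R) :
  is_derive f t l -> is_time_derive f t l.
Proof.
intros H. apply is_derive_Reals, (derivable_pt_lim_D_in f (fun _ => l)) in H.
exact (D_in_imp f _ no_cond _ t (fun _ _ => I) H).
Qed.

(** Here [phi] is the field in terms of phase and depth. The spatial gradient is [(la, lb)] times
    the inverse Jacobian, and time enters only through [X - c * t], whence the factor [- c]. *)
Lemma moving_frame_derivatives (V : R -> R -> R -> R) (k m c b0 t : R) (p0 : C)
  (phi : R -> R -> R) (la lb : R) :
  0 < k -> b0 <= 0 -> snd p0 < b0 ->
  (forall s p, snd p < b0 ->
     V s (fst (trochoid k p) + c * s) (snd (trochoid k p)) = phi (fst p) (snd p)) ->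
  differentiable_pt_lim phi (fst p0) (snd p0) la lb ->
  let e := exp (k * snd p0) in
  let co := cos (k * fst p0) in
  let si := sin (k * fst p0) in
  let X := fst (trochoid k p0) + c * t in
  let Z := snd (trochoid k p0) in
  let V_X := (la * (1 + e * co) + lb * (e * si)) / (1 - e ^ 2) in
  let V_Z := (la * (e * si) + lb * (1 - e * co)) / (1 - e ^ 2) in
  is_time_derive (fun s => V s X Z) t (- c * V_X) /\
  is_derive (fun x => V t x Z) X V_X /\
  is_derive (fun z => V t X z) Z V_Z.
Proof.
intros Hk Hb0 Hp0 HV Hphi e co si X Z V_X V_Z.
assert (He : 0 < e < 1) by (split; [apply exp_pos | apply exp_mul_lt_1; lra]).
assert (Hinv : trochoid_inv k b0 (fst (trochoid k p0), snd (trochoid k p0)) = p0).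
{ rewrite <- surjective_pairing. apply trochoid_inv_trochoid; assumption. }
destruct (trochoid_inv_differentiable k b0 p0 Hk Hb0 Hp0) as [HA HB].
fold e co si in HA, HB.
assert (HX : X - c * t = fst (trochoid k p0)) by (unfold X; ring).
edestruct (travelling_wave_derivatives V
  (fun x z => phi (fst (trochoid_inv k b0 (x, z))) (snd (trochoid_inv k b0 (x, z))))
  c t X Z V_X V_Z) as [H1 H2].
- rewrite HX.
  replace V_X with (la * ((1 + e * co) / (1 - e ^ 2)) + lb * (e * si / (1 - e ^ 2)))
    by (unfold V_X; field; nra).
  replace V_Z with (la * (e * si / (1 - e ^ 2)) + lb * ((1 - e * co) / (1 - e ^ 2)))
    by (unfold V_Z; field; nra).
  apply differentiable_pt_lim_comp; [|exact HA | exact HB].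
  unfold Z. rewrite Hinv. exact Hphi.
- rewrite HX. destruct (trochoid_inv_locally k b0 p0 Hk Hb0 Hp0) as [K [d HK]].
  exists d. intros x z Hx Hz s.
  destruct (HK x z Hx Hz) as [Hb [Heq _]].
  rewrite <- (HV s _ Hb), Heq. reflexivity.
- split; [apply is_derive_is_time_derive, H1 | exact H2].
Qed.

(** * Verification of the Euler equations *)

Theorem lemma3p3 (k g rho omega b0 P0 m c : R)
  (hk : 0 < k) (hg : 0 < g) (hrho : 0 < rho) (homega : 0 < omega)
  (hb0 : b0 <= 0)
  (hc : c = (g - k * m ^ 2) / (2 * omega)) :
  let u := velocity_u k m c b0 in
  let w := velocity_w k m c b0 in
  let P := pressure k g rho omega b0 P0 m c in
  forall t : R, 0 <= t ->
  forall X Z : R, Omega k m c b0 t (X, Z) ->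
  exists u_t u_X u_Z w_t w_X w_Z P_X P_Z : R,
    is_time_derive (fun s => u s X Z) t u_t /\
    is_derive (fun x => u t x Z) X u_X /\
    is_derive (fun z => u t X z) Z u_Z /\
    is_time_derive (fun s => w s X Z) t w_t /\
    is_derive (fun x => w t x Z) X w_X /\
    is_derive (fun z => w t X z) Z w_Z /\
    is_derive (fun x => P t x Z) X P_X /\
    is_derive (fun z => P t X z) Z P_Z /\
    u_t + u t X Z * u_X + w t X Z * u_Z + 2 * omega * w t X Z = - (P_X / rho) /\
    w_t + u t X Z * w_X + w t X Z * w_Z - 2 * omega * u t X Z = - (P_Z / rho) - g.
Proof.
intros u w P t _ X Z [[a b] [Hb HPhi]]. unfold Sigma in Hb; simpl in Hb.
rewrite Phi_trochoid in HPhi. injection HPhi as <- <-.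
set (p0 := (a - m * t, b) : C).
assert (Hp0 : snd p0 < b0) by exact Hb.
(* The zero coefficients put the field in the shape of [affine_add_exp_trig_differentiable], so that
   its differential is found by unification. *)
assert (Hu : forall s p, snd p < b0 ->
  u s (fst (trochoid k p) + c * s) (snd (trochoid k p))
  = (c - m) + 0 * fst p + 0 * snd p
    + exp (k * snd p) * (m * cos (k * fst p) + 0 * sin (k * fst p))).
{ intros s p Hp. unfold u, velocity_u. rewrite Phi_inv_trochoid by assumption.
  rewrite Derive_Xpath by exact hk. simpl.
  replace (fst p + m * s - m * s) with (fst p) by ring. ring. }
assert (Hw : forall s p, snd p < b0 ->
  w s (fst (trochoid k p) + c * s) (snd (trochoid k p))
  = 0 + 0 * fst p + 0 * snd p
    + exp (k * snd p) * (0 * cos (k * fst p) + m * sin (k * fst p))).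
{ intros s p Hp. unfold w, velocity_w. rewrite Phi_inv_trochoid by assumption.
  rewrite Derive_Zpath by exact hk. simpl.
  replace (fst p + m * s - m * s) with (fst p) by ring. ring. }
assert (HP : forall s p, snd p < b0 ->
  P s (fst (trochoid k p) + c * s) (snd (trochoid k p))
  = pressure_label k g rho omega b0 P0 m c (snd p)).
{ intros s p Hp. unfold P, pressure. rewrite Phi_inv_trochoid by assumption. reflexivity. }
set (P_b := rho * m * (k * m + 2 * omega) * exp (k * b) ^ 2
            + (2 * omega * rho * (c - m) - g * rho)).
assert (HPb : derivable_pt_lim (pressure_label k g rho omega b0 P0 m c) b P_b).
{ apply is_derive_Reals. unfold pressure_label, P_b. auto_derive; [trivial|].
  replace (exp (2 * k * b)) with (exp (k * b) ^ 2)
    by (simpl; rewrite Rmult_1_r, <- exp_plus; f_equal; ring).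
  field. lra. }
destruct (moving_frame_derivatives u k m c b0 t p0 _ _ _ hk hb0 Hp0 Hu
  (affine_add_exp_trig_differentiable _ _ _ _ _ _ _ _)) as [Hut [Hux Huz]].
destruct (moving_frame_derivatives w k m c b0 t p0 _ _ _ hk hb0 Hp0 Hw
  (affine_add_exp_trig_differentiable _ _ _ _ _ _ _ _)) as [Hwt [Hwx Hwz]].
destruct (moving_frame_derivatives P k m c b0 t p0
  (fun _ b => pressure_label k g rho omega b0 P0 m c b) 0 P_b hk hb0 Hp0 HP)
  as [_ [HPx HPz]].
(* The pressure depends on depth alone: the one-variable estimate is read on the diagonal [(y, y)],
   where the max norm collapses to the distance from [b]. *)
{ intros eps.
  destruct (differentiable_pt_lim_proj1_0 _ b b P_b HPb eps) as [d Hd].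
  exists d. simpl. intros x y Hx Hy. specialize (Hd y y Hy Hy).
  rewrite Rmax_left in Hd by lra.
  replace (0 * (x - (a - m * t)) + P_b * (y - b)) with (P_b * (y - b) + 0 * (y - b)) by ring.
  eapply Rle_trans; [exact Hd|].
  apply Rmult_le_compat_l; [left; apply cond_pos | apply Rmax_r]. }
pose proof (Hu t p0 Hp0) as Hu0. pose proof (Hw t p0 Hp0) as Hw0.
clear Hu Hw HP HPb.
assert (He : 0 < exp (k * b) < 1) by (split; [apply exp_pos | apply exp_mul_lt_1; lra]).
pose proof (sin2_cos2 (k * (a - m * t))) as Hsc. unfold Rsqr in Hsc.
assert (Hg : g = 2 * omega * c + k * m ^ 2) by (rewrite hc; field; lra).
simpl in *.
set (e := exp (k * b)) in *.
set (co := cos (k * (a - m * t))) in *. set (si := sin (k * (a - m * t))) in *.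
assert (HD : 1 - e ^ 2 <> 0) by nra.
assert (Hsi : si * si = 1 - co * co) by lra.
do 8 eexists.
repeat (split; [eassumption|]).
rewrite Hu0, Hw0. unfold P_b. rewrite Hg. simpl in HD |- *.
(* With [g] eliminated, both equations are rational identities in [e], [co], [si] and the
   parameters; [Hsi] reduces them modulo the Pythagorean relation. *)
split; field [Hsi]; lra.
Qed.
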